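(* Let $\beta$ be a Pisot number or a Salem number, and let $\xi$ be a Liouville number. Then the sequence of digits of the $\beta$-expansion of $\xi$ is not $k$-automatic for any integer $k\geq 2$.
   Context: A Pisot (resp. Salem) number is a real algebraic integer $\beta>1$ all of whose other complex conjugates lie in the open unit disc (resp. in the closed unit disc, with at least one on the unit circle). The $\beta$-expansion (Rényi) of $x\in[0,1)$ is $d_\beta(x)=0.x_1x_2\ldots$ with $x_n=\lfloor \beta T_\beta^{n-1}(x)\rfloor$, where $T_\beta(y)=\beta y-\lfloor\beta y\rfloor$; so $x=\sum_{n\geq1}x_n\beta^{-n}$ with digits in $\{0,\dots,\lfloor\beta\rfloor\}$ (greedy algorithm); for a real $\xi\ge 0$ we write $d_\beta(\xi)=a_0.a_1a_2\ldots$ with $a_0=\lfloor\xi\rfloor$ and $0.a_1a_2\ldots=d_\beta(\xi-\lfloor\xi\rfloor)$. A Liouville number is an irrational $\xi$ such that for every $\tau>0$ the inequality $|\xi-p/q|<q^{-\tau}$ has a solution in integers $p,q$, $q\geq1$. A sequence $(a_n)$ is $k$-automatic if it is the image under a letter-to-letter map of a fixed point of a morphism sending each letter to a word of length $k$ (equivalently, $a_n$ is computed by a finite automaton reading the base-$k$ digits of $n$).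
   Formalization: Liouville numbers are taken with denominators q ≥ 2 instead of q ≥ 1: with q = 1 allowed, p = ⌊ξ⌋ always solves the inequality, every irrational would be Liouville, and the claim fails for β = 2 and ξ the Thue–Morse number. *)

(* Defs.v *)
From mathcomp Require Import all_boot all_order all_algebra.
From mathcomp Require Import complex.
From mathcomp Require Import boolp classical_sets reals exp.

Set Implicit Arguments.
Unset Strict Implicit.
Unset Printing Implicit Defensive.

Import Order.TTheory GRing.Theory Num.Theory.

Local Open Scope ring_scope.
Local Open Scope complex_scope.

(* This determines p uniquely, once x is algebraic over the rationals. *)
Definition is_minpoly (K : numFieldType) (p : {poly rat}) (x : K) : Prop :=
  [/\ p \is monic, irreducible_poly p & root (map_poly ratr p) x].

Definition other_conjugate (R : realType) (beta : R) (z : R[i]) : Prop :=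
  z <> beta%:C /\
  exists2 p : {poly rat}, is_minpoly p beta & root (map_poly ratr p) z.

Definition algebraic_integer (R : realType) (x : R) : Prop :=
  integralOver (intr : int -> R) x.

(* The norm of R[i] takes its values in R[i] (it is a nonnegative real there),
   so the comparisons with 1 below are those of R[i]. *)
Definition pisot (R : realType) (beta : R) : Prop :=
  [/\ algebraic_integer beta, 1 < beta
    & forall z : R[i], other_conjugate beta z -> `|z| < 1].

Definition salem (R : realType) (beta : R) : Prop :=
  [/\ algebraic_integer beta, 1 < beta,
      forall z : R[i], other_conjugate beta z -> `|z| <= 1
    & exists2 z : R[i], other_conjugate beta z & `|z| = 1].

Definition beta_transform (R : realType) (beta y : R) : R :=
  beta * y - (Num.floor (beta * y))%:~R.

(* The digits a_0, a_1, a_2, ... of d_beta(xi) = a_0.a_1a_2..., for xi >= 0: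
   a_0 is the integer part, and a_(n+1) is the (n+1)-st Renyi digit
   floor(beta * T^n(x)) of the fractional part x of xi. *)
Definition beta_digit (R : realType) (beta xi : R) (n : nat) : int :=
  if n is m.+1 then
    Num.floor (beta * iter m (beta_transform beta) (xi - (Num.floor xi)%:~R))
  else Num.floor xi.

(* Denominators are at least 2: with q = 1 the inequality would read
   |xi - p| < 1, which always has a solution, and every irrational number
   would be a Liouville number. *)
Definition liouville (R : realType) (xi : R) : Prop :=
  irrational xi /\
  forall tau : R, 0 < tau ->
    exists p q : int,
      1 < q /\ `|xi - p%:~R / q%:~R| < (q%:~R : R) `^ (- tau).

(* The infinite word u is fixed by the morphism that sends each letter x to the
   word sigma x of length k: the m-th block of length k of sigma(u), which is
   sigma (u m), is the m-th block of length k of u. *)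
Definition uniform_fixed_point (A : finType) (k : nat) (sigma : A -> k.-tuple A)
    (u : nat -> A) : Prop :=
  forall (m : nat) (j : 'I_k), u (k * m + j)%N = tnth (sigma (u m)) j.

Definition automatic (T : Type) (k : nat) (a : nat -> T) : Prop :=
  exists (A : finType) (sigma : A -> k.-tuple A) (u : nat -> A) (phi : A -> T),
    uniform_fixed_point sigma u /\ forall n, a n = phi (u n).

(* Main.v *)
Require Import Defs.
From mathcomp Require Import all_boot all_order all_algebra.
From mathcomp Require Import complex.
From mathcomp Require Import boolp classical_sets reals exp.
From mathcomp Require algebraics_fundamentals.
From mathcomp Require Import zify ring lra.

(* If beta is Pisot or Salem and the digits of xi are k-automatic, then xi has
   a finite irrationality measure.  Let u be the fixed point behind the digits
   a, let N = k ^ n and B = beta ^ N.  For y real put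
     y_m = beta ^ m * (y - sum_(t < m) a_t beta ^ (- t)),
   so that xi_m is bounded and y_m - xi_m = beta ^ m * (y - xi).
   If u_i = u_j, the length-N blocks of digits starting at N * i and N * j
   agree, hence xi_(N i) - xi_(N j) = O(1 / B).  Given y = p / q <> xi, there are
   such i, j below a bound J that depends only on u with y_(N i) <> y_(N j).
   Now q * (y_(N i) - y_(N j)) is the value at beta of an integer polynomial
   which is O(q N) on the closed unit disc, hence at the other conjugates of
   beta; taking norms, its absolute value is at least c * (q N) ^ (- d).  When B
   is about a fixed power of q, the error O(1 / B) is negligible against this,
   and |xi - p / q| is at least B ^ (- J - 1), a fixed negative power of q. *)

Set Implicit Arguments.
Unset Strict Implicit.
Unset Printing Implicit Defensive.

Import Order.TTheory GRing.Theory Num.Theory.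

Local Open Scope ring_scope.

(** * Integer norms: products over the roots of a monic polynomial *)

(** Split [q] into linear factors X - w: the determinant of A - w is the product of the z - w, and
    the products over z and w are exchanged. *)
Lemma det_horner_mx (F : closedFieldType) n (A : 'M[F]_n.+1) (q : {poly F})
    (rs : seq F) :
  char_poly A = \prod_(z <- rs) ('X - z%:P) ->
  \det (horner_mx A q) = \prod_(z <- rs) q.[z].
Proof.
move=> Ars; have szrs : size rs = n.+1.
  by have := size_char_poly A; rewrite Ars size_prod_XsubC => -[].
have detA w : \det (A - w%:M) = \prod_(z <- rs) (z - w).
  have -> : A - w%:M = - 1 *: map_mx (horner_eval w) (char_poly_mx A).
    apply/matrixP=> i j; rewrite !mxE /horner_eval !hornerE; case: eqP => _ //=;
    by rewrite ?mulr1n ?mulr0n !hornerE; ring.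
  rewrite detZ det_map_mx /= -/(char_poly A) Ars /horner_eval horner_prod.
  have -> : (- 1 : F) ^+ n.+1 = \prod_(z <- rs) (- 1).
    by rewrite big_const_seq count_predT szrs iter_mulr_1.
  rewrite -big_split; apply: eq_bigr => z _; rewrite !hornerE /=; ring.
have [ws ->] := closed_field_poly_normal q.
rewrite linearZ /= detZ rmorph_prod /=.
rewrite (big_morph determinant (@det_mulmx F n.+1) (det1 F n.+1)).
under eq_bigr do rewrite rmorphB /= horner_mx_X horner_mx_C detA.
under [RHS]eq_bigr do rewrite hornerZ horner_prod.
rewrite big_split /= exchange_big /= -szrs; congr (_ * _).
  by rewrite big_const_seq count_predT iter_mulr_1.
by apply: eq_bigr => z _; apply: eq_bigr => w _; rewrite !hornerE.
Qed.

Lemma char_poly_surj (S : comNzRingType) (p : {poly S}) :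
  p \is monic -> (1 < size p)%N -> exists n (A : 'M[S]_n.+1), char_poly A = p.
Proof.
move=> p_monic; have := companionmxK p_monic.
move: (companionmx p); case: (size p) => [|[|n]] //= A Ap _.
by exists n, A.
Qed.

(** The product is the determinant of [Q] evaluated at the companion matrix of [p], which has
    integer entries. *)
Lemma prod_horner_int (F : closedFieldType) (p Q : {poly int}) (rs : seq F) :
  p \is monic -> map_poly intr p = \prod_(z <- rs) ('X - z%:P) ->
  exists m : int, \prod_(z <- rs) (map_poly intr Q).[z] = m%:~R.
Proof.
move=> p_monic prs; case: (ltnP 1 (size p)) => [p_gt1|].
  have [n [A Ap]] := char_poly_surj p_monic p_gt1.
  exists (\det (horner_mx A Q)); rewrite -(@det_horner_mx _ n (map_mx intr A)).
    by rewrite -map_horner_mx det_map_mx.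
  by rewrite -map_char_poly Ap.
move=> p_le1; exists 1; suff -> : rs = [::] by rewrite big_nil.
have := size_prod_XsubC rs id; rewrite -prs.
rewrite size_map_poly_id0 ?(monicP p_monic) ?oner_neq0 //.
by case: rs {prs} => //= a l; case: (size p) p_le1 => [|[]].
Qed.

(** * Minimal polynomials of algebraic integers and a Liouville-type lower bound *)

Lemma map_poly_ratr_int (F : numFieldType) (p : {poly int}) :
  map_poly ratr (map_poly intr p : {poly rat}) = map_poly intr p :> {poly F}.
Proof. by rewrite -map_poly_comp; apply: eq_map_poly => c /=; rewrite ratr_int. Qed.

Lemma horner_map_complex (R : realType) (p : {poly int}) (x : R) :
  (map_poly intr p).[x%:C%C] = ((map_poly intr p).[x])%:C%C.
Proof.
have -> : map_poly intr p = map_poly (real_complex R) (map_poly intr p : {poly R}).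
  by rewrite -map_poly_comp; apply: eq_map_poly => c /=; rewrite rmorph_int.
exact: horner_map.
Qed.

(** Gauss's lemma: the rational minimal polynomial divides a monic integer one, so it is
    proportional to an integer factor with leading coefficient 1 or -1. It is first obtained over
    R[i], an algebraically closed field. *)
Lemma integer_minpoly (R : realType) (x : R) :
  algebraic_integer x ->
  exists2 p : {poly int}, p \is monic & is_minpoly (map_poly intr p) x.
Proof.
move=> [q q_monic /rootP qx].
have decQ : algebraics_fundamentals.decidable_embedding (ratr : rat -> R[i]).
  by move=> z; apply: pselect.
have xint : integralOver (ratr : rat -> R[i]) x%:C%C.
  exists (map_poly intr q); first exact: monic_map.
  by rewrite map_poly_ratr_int; apply/rootP; rewrite horner_map_complex qx.
have [p [p_monic px p_irr]] :=
  algebraics_fundamentals.minPoly_decidable_closure decQ xint.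
have : p %| map_poly intr q.
  apply: contraT; rewrite -irreducible_poly_coprime //.
  rewrite -(coprimep_map (ratr : {rmorphism rat -> R[i]})) => /coprimep_root /(_ px).
  by rewrite map_poly_ratr_int horner_map_complex qx eqxx.
move=> /dvdpP_rat_int[p1 [a a_neq0 pE] [r qE]].
have : lead_coef p1 * lead_coef r = 1.
  by rewrite -lead_coefM -qE; apply/eqP.
move=> lead1; pose s := lead_coef p1.
have s2 : s * s = 1.
  move: lead1 => /(congr1 absz); rewrite abszM => /eqP.
  rewrite muln_eq1 -/s => /andP[/eqP s1 _].
  by have [->|->] : s = 1 \/ s = -1 by lia.
have p2_monic : s *: p1 \is monic by rewrite monicE lead_coefZ s2.
have pE' : p = map_poly intr (s *: p1).
  have sa : a * (s%:~R : rat) = 1.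
    have := monicP p_monic; rewrite pE lead_coefZ lead_coef_map_inj //.
    exact: intr_inj.
  have aE : a = s%:~R.
    have <- : a * (s * s)%:~R = s%:~R by rewrite intrM mulrA sa mul1r.
    by rewrite s2 mulr1.
  by rewrite pE aE map_polyZ.
exists (s *: p1) => //; rewrite -pE'; split=> //.
move: px; rewrite pE' !map_poly_ratr_int /root horner_map_complex.
by rewrite (fmorph_eq0 (real_complex R)).
Qed.

(* The product of Q over the roots of the minimal polynomial is a nonzero
   integer, and each factor other than Q(beta) is at most M. *)
Lemma int_poly_lower_bound (R : realType) (beta : R) :
  algebraic_integer beta ->
  (forall z : R[i], other_conjugate beta z -> `|z| <= 1) ->
  exists d : nat, forall (Q : {poly int}) (M : R), 1 <= M ->
    (forall z : R[i], `|z| <= 1 -> `|(map_poly intr Q).[z]| <= M%:C%C) ->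
    (map_poly intr Q).[beta] != 0 -> 1 <= `|(map_poly intr Q).[beta]| * M ^+ d.
Proof.
move=> /integer_minpoly[p p_monic [p1_monic p_irr pbeta]] conj1.
have [rs] := closed_field_poly_normal (map_poly intr p : {poly R[i]}).
rewrite (monicP (monic_map _ p_monic)) scale1r => prs.
have rsE z : z \in rs -> z = beta%:C%C \/ `|z| <= 1.
  move=> zrs; have [->|zb] := eqVneq z beta%:C%C; [by left|right].
  apply: conj1; split; first exact/eqP.
  by exists (map_poly intr p); rewrite ?map_poly_ratr_int ?prs ?root_prod_XsubC.
have brs : beta%:C%C \in rs.
  rewrite -root_prod_XsubC -prs; move: pbeta.
  by rewrite map_poly_ratr_int /root horner_map_complex => /eqP ->.
exists (size rs) => Q M M1 QM Qb.
(* If the value at [beta] is at least [M], the claim is immediate; otherwise [M] bounds it too,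
   which covers any further occurrence of [beta] in [rs]. *)
have [x_le|/ltW x_ge] := leP `|(map_poly intr Q).[beta]| M; last first.
  by apply: le_trans (le_trans M1 x_ge) _; rewrite ler_peMr ?exprn_ege1.
(* A common root with the irreducible [p] would make [p] divide [Q], so that [Q] would vanish at
   [beta]. *)
have Qrs z : z \in rs -> (map_poly intr Q).[z] != 0.
  move=> zrs; have : coprimep (map_poly intr p : {poly rat}) (map_poly intr Q).
    rewrite irreducible_poly_coprime //; apply: contra Qb.
    rewrite -(dvdp_map (ratr : {rmorphism rat -> R})) map_poly_ratr_int.
    rewrite map_poly_ratr_int => /dvdpP[r ->].
    by move: pbeta; rewrite map_poly_ratr_int hornerM => /rootP ->; rewrite mulr0.
  rewrite -(coprimep_map (ratr : {rmorphism rat -> R[i]})) !map_poly_ratr_int.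
  by move/coprimep_root; apply; rewrite prs root_prod_XsubC.
have Qrs_le z : z \in rs -> `|(map_poly intr Q).[z]| <= M%:C%C.
  move=> /rsE[-> |/QM//]; rewrite horner_map_complex normc_def /= expr0n addr0.
  by rewrite sqrtr_sqr lecR.
have [m mE] := prod_horner_int Q p_monic prs.
have m1 : 1 <= `|m%:~R : R[i]|.
  rewrite -intr_norm ler1z -gtz0_ge1 normr_gt0 -(intr_eq0 R[i]) -mE.
  by rewrite prodf_seq_neq0; apply/allP => z /Qrs.
rewrite -lecR; apply: le_trans m1 _; rewrite -mE normr_prod.
rewrite (perm_big _ (perm_to_rem brs)) big_cons horner_map_complex normc_def /=.
rewrite expr0n addr0 sqrtr_sqr rmorphM /= ler_wpM2l //.
  by rewrite -[0]/(0%:C%C) lecR.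
apply: (@le_trans _ _ (\prod_(z <- rem beta%:C%C rs) M%:C%C)).
  rewrite [leLHS]big_seq [leRHS]big_seq; apply: ler_prod => z /mem_rem zrs.
  by rewrite normr_ge0 Qrs_le.
rewrite big_const_seq count_predT iter_mulr_1 -rmorphXn lecR.
by rewrite ler_weXn2l // size_rem // leq_pred.
Qed.

(** * Repeated blocks in a fixed point *)

(** Both blocks are the n-th image of the same letter: position t has offset t mod k in the image of
    the letter at position t / k one level down. *)
Lemma fixed_point_block (A : finType) (k : nat) (sigma : A -> k.-tuple A)
    (u : nat -> A) (n i j t : nat) :
  uniform_fixed_point sigma u -> u i = u j -> (t < k ^ n)%N ->
  u (k ^ n * i + t)%N = u (k ^ n * j + t)%N.
Proof.
move=> u_fix uij; elim: n t => [|n IHn] t.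
  by rewrite expn0 ltnS leqn0 => /eqP ->; rewrite !mul1n !addn0.
rewrite expnS => lt_t; have k_gt0 : (0 < k)%N by case: k lt_t {sigma u_fix IHn}.
have blockE l : (k * k ^ n * l + t = k * (k ^ n * l + t %/ k) + t %% k)%N.
  by rewrite {1}(divn_eq t k) mulnDr mulnA [(t %/ k * k)%N]mulnC addnA.
have lt_mod : (t %% k < k)%N by rewrite ltn_mod.
rewrite !blockE !(u_fix _ (Ordinal lt_mod)) IHn //.
by rewrite ltn_divLR // mulnC.
Qed.

Lemma finite_range_bound (T : finType) (g : nat -> T) :
  exists J, forall i, exists2 j, (j < J)%N & g j = g i.
Proof.
have /choice[h hP] (t : T) : exists i, forall j, g j = t -> g i = t.
  have [[i it]|no] := pselect (exists i, g i = t); first by exists i.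
  by exists 0%N => j jt; case: no; exists j.
exists (\max_t h t).+1 => i; exists (h (g i)); last exact: hP.
by rewrite ltnS leq_bigmax.
Qed.

(** * Tails of digit expansions *)

(* [beta ^+ m] times the error of the approximation of [x] by the first [m]
   terms of the series of the [a n * beta ^- n]. *)
Fixpoint beta_tail (R : realType) (beta : R) (a : nat -> int) (x : R) (m : nat) : R :=
  if m is l.+1 then beta * (beta_tail beta a x l - (a l)%:~R) else x.

Lemma beta_tail_sub (R : realType) (beta : R) a x y m :
  beta_tail beta a x m - beta_tail beta a y m = beta ^+ m * (x - y).
Proof.
elim: m => [|m IHm] /=; first by rewrite mul1r.
by rewrite exprS -mulrA -IHm; ring.
Qed.

Lemma beta_tail_shift (R : realType) (beta : R) a x l m N :
  (forall t, (t < N)%N -> a (l + t)%N = a (m + t)%N) ->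
  beta_tail beta a x (l + N) - beta_tail beta a x (m + N) =
  beta ^+ N * (beta_tail beta a x l - beta_tail beta a x m).
Proof.
elim: N => [|N IHN] alm; first by rewrite !addn0 mul1r.
rewrite !addnS /= alm // exprS -mulrA -IHN; first by ring.
by move=> t /ltnW; apply: alm.
Qed.

(** Along its own digits, the later tails of [xi] are [beta] times points of [0, 1), which is why
    they stay bounded. *)
Lemma beta_tail_digit (R : realType) (beta xi : R) m :
  beta_tail beta (beta_digit beta xi) xi m.+1 =
  beta * iter m (beta_transform beta) (xi - (Num.floor xi)%:~R).
Proof. by elim: m => [//|m IHm]; rewrite [LHS]/= -/(beta_tail _ _ _ m.+1) IHm. Qed.

Lemma subr_floor_itv (R : realType) (x : R) : 0 <= x - (Num.floor x)%:~R < 1.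
Proof. by have := floor_itv x; rewrite intrD; lra. Qed.

Lemma beta_tail_digit_bound (R : realType) (beta xi : R) m :
  0 <= beta -> 0 <= xi ->
  0 <= beta_tail beta (beta_digit beta xi) xi m <= xi + beta.
Proof.
move=> beta0 xi0; case: m => [|m]; first by rewrite /=; lra.
rewrite beta_tail_digit; set x := iter _ _ _.
have /andP[x0 x1] : 0 <= x < 1.
  by rewrite /x; case: m {x} => [|m]; apply: subr_floor_itv.
by rewrite mulr_ge0 //= -[leLHS]addr0 addrC lerD // ler_piMr // ltW.
Qed.

Lemma beta_digitE (R : realType) (beta xi : R) m :
  beta_digit beta xi m = Num.floor (beta_tail beta (beta_digit beta xi) xi m).
Proof. by case: m => // m; rewrite beta_tail_digit. Qed.

Lemma beta_digit_bound (R : realType) (beta xi : R) m :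
  0 <= beta -> 0 <= xi -> `|beta_digit beta xi m|%:~R <= xi + beta.
Proof.
move=> beta0 xi0; have /andP[ge0 le_xb] := beta_tail_digit_bound m beta0 xi0.
rewrite beta_digitE ger0_norm ?floor_ge0 //.
by apply: le_trans le_xb; apply: floor_le.
Qed.

(** The factor q clears the only denominator, and the recursion becomes Q -> X (Q - q a_m). On the
    closed unit disc X does not increase the modulus, so the bound grows only linearly in m. *)
Lemma beta_tail_poly (R : realType) (beta C : R) (a : nat -> int) (p q : int) m :
  (forall t, `|a t|%:~R <= C) -> q != 0 ->
  exists2 Q : {poly int},
    (map_poly intr Q).[beta] = q%:~R * beta_tail beta a (p%:~R / q%:~R) m &
    forall z : R[i], `|z| <= 1 ->
      `|(map_poly intr Q).[z]| <= (`|p|%:~R + m%:R * `|q|%:~R * C)%:C%C.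
Proof.
move=> aC q0; elim: m => [|m [Q Qbeta Qz]].
  exists p%:P => [|z _]; rewrite map_polyC hornerC /=.
    by rewrite mulrC divfK // intr_eq0.
  by rewrite !mul0r addr0 -intr_norm rmorph_int.
exists ('X * (Q - (q * a m)%:P)) => [|z z1];
  rewrite rmorphM rmorphB /= map_polyX map_polyC !hornerE /=.
  by rewrite Qbeta intrM; ring.
rewrite normrM -[leRHS]mul1r; apply: ler_pM => //.
apply: le_trans (ler_normB _ _) _.
rewrite -natr1 2!mulrDl mul1r addrA rmorphD; apply: lerD; first exact: Qz.
rewrite -intr_norm -(rmorph_int (real_complex R)) lecR normrM intrM.
by rewrite ler_wpM2l // ler0z.
Qed.

(** * Choice of the scale *)

(** Each induction step spends one factor sqrt(beta) ^ N on one power of N, by Bernoulli's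
    inequality. *)
Lemma exprn_bound_by_exponential (R : realType) (d : nat) (beta : R) : 1 < beta ->
  exists2 G : R, 1 <= G & forall N : nat, N%:R ^+ d <= G * beta ^+ N.
Proof.
elim: d beta => [|d IHd] beta beta1.
  by exists 1 => // N; rewrite mul1r exprn_ege1 // ltW.
pose gam := Num.sqrt beta.
have gam1 : 1 < gam by rewrite -[1]sqrtr1 ltr_sqrt //; lra.
have gamE : beta = gam * gam by rewrite -expr2 sqr_sqrtr //; lra.
have [G G1 GP] := IHd gam gam1.
have lin N : N%:R <= (gam - 1)^-1 * gam ^+ N.
  rewrite ler_pdivlMl ?subr_gt0 //; elim: N => [|N IHN]; first by rewrite mulr0.
  have : 1 <= gam ^+ N by apply: exprn_ege1; apply: ltW.
  rewrite exprS -natr1; move: (gam ^+ N) (N%:R) IHN => g n.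
  by nra.
exists (Num.max 1 ((gam - 1)^-1 * G)); first by rewrite le_max lexx.
move=> N; apply: (@le_trans _ _ ((gam - 1)^-1 * G * beta ^+ N)); last first.
  by rewrite ler_wpM2r ?le_max ?lexx ?orbT // exprn_ge0 //; lra.
rewrite exprS gamE exprMn mulrACA; apply: ler_pM; rewrite ?exprn_ge0 //.
Qed.

Lemma scale_choice (R : realType) (beta G : R) (k e d : nat) :
  1 < beta -> (2 <= k)%N -> 1 <= G ->
  exists T, forall q : R, 2 <= q -> exists n,
    q ^+ e * G * (k ^ n)%:R ^+ d <= beta ^+ (k ^ n) <= q ^+ T.
Proof.
move=> beta1 k2 G1.
have [G0' G0'_ge1 lin] := exprn_bound_by_exponential 1 beta1.
have [G3 G31 GP] := exprn_bound_by_exponential (d * 2) beta1.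
pose H := G ^+ 2 * G3.
have H1 : 1 <= H by rewrite -[1]mulr1 ler_pM // exprn_ege1.
pose g := Num.bound (H + beta).
have Hg : H + beta < 2 ^+ g by apply: upper_nthrootP.
(* For the least n with q^(2e) H <= beta^(k^n), the preceding scale is below q^(2e + g), and the
   k-th power gives T. The summand [beta] in the choice of g serves n = 0. *)
exists ((e * 2 + g) * k)%N => q q2.
have q0 : 0 <= q by lra.
have G0 : 0 <= G by lra.
have beta0 : 0 <= beta by lra.
have H0 : 0 <= H by lra.
have q1 : 1 <= q by lra.
have qg : H + beta <= q ^+ g.
  by apply: le_trans (ltW Hg) _; rewrite lerXn2r ?nnegrE //; lra.
pose P n := q ^+ (e * 2) * H <= beta ^+ (k ^ n).
have exP : exists n, P n.
  pose n := Num.bound (G0' * (q ^+ (e * 2) * H)); exists n.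
  have qH0 : 0 <= q ^+ (e * 2) * H by rewrite mulr_ge0 ?exprn_ge0 //; lra.
  have : G0' * (q ^+ (e * 2) * H) < n%:R by apply: archi_boundP; rewrite mulr_ge0 //; lra.
  rewrite /P -(@ler_pM2l _ G0') => [/ltW le_n|]; last exact: lt_le_trans ltr01 G0'_ge1.
  apply: le_trans le_n _; apply: le_trans (lin (k ^ n)%N).
  by rewrite expr1 ler_nat ltnW // ltn_expl.
have [n Pn minP] := ex_minnP exP.
have B1 : 1 <= beta ^+ (k ^ n) by apply: exprn_ege1; apply: ltW.
have B0 : 0 <= beta ^+ (k ^ n) by rewrite exprn_ge0.
exists n; apply/andP; split.
  (* After squaring, N^(2d) costs one factor G3 B, and the choice of n pays for the rest with the
     other factor B. *)
  rewrite -(@ler_pXn2r _ 2) // ?nnegrE ?mulr_ge0 ?exprn_ge0 //.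
  rewrite !exprMn -!exprM [leRHS]exprM expr2.
  apply: (@le_trans _ _ (q ^+ (e * 2) * H * beta ^+ (k ^ n))).
    rewrite /H -!mulrA ler_wpM2l ?exprn_ge0 //.
    by rewrite !ler_wpM2l.
  by rewrite ler_wpM2r.
case: n Pn minP B1 B0 => [|n] Pn minP B1 B0.
  rewrite expn0 expr1; apply: (@le_trans _ _ (q ^+ g)).
    by apply: le_trans qg; rewrite lerDr.
  by rewrite ler_weXn2l // mulnDl (leq_trans _ (leq_addl _ _)) // leq_pmulr // ltnW.
rewrite expnS mulnC exprM exprM lerXn2r ?nnegrE ?exprn_ge0 //.
have le_n : beta ^+ (k ^ n) <= q ^+ (e * 2) * H.
  by rewrite ltW // ltNge; apply/negP => /minP; rewrite ltnn.
apply: le_trans le_n _; rewrite exprD ler_wpM2l ?exprn_ge0 //.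
by apply: le_trans qg; rewrite lerDl.
Qed.

(** * Separation of the tails of a rational approximation *)

Lemma automatic_block (T : Type) (k : nat) (a : nat -> T) : automatic k a ->
  exists (A : finType) (u : nat -> A), forall n i j, u i = u j ->
    forall t, (t < k ^ n)%N -> a (k ^ n * i + t)%N = a (k ^ n * j + t)%N.
Proof.
move=> [A [sigma [u [phi [u_fix aE]]]]]; exists A, u => n i j uij t lt_t.
by rewrite !aE (fixed_point_block u_fix uij).
Qed.

(* If the tails of y depended only on the letter u i, their recursion would
   keep them within finitely many values; being bounded, they would force
   y = x, because the tails of x and y differ by beta ^+ m * (x - y). *)
Lemma beta_tail_separation (R : realType) (A : finType) (u : nat -> A)
    (a : nat -> int) (beta x y C : R) (N J : nat) :
  1 < beta -> (0 < N)%N ->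
  (forall i j, u i = u j ->
     forall t, (t < N)%N -> a (N * i + t)%N = a (N * j + t)%N) ->
  (forall i, exists2 j, (j < J)%N & (u j, u j.+1) = (u i, u i.+1)) ->
  (forall m, `|beta_tail beta a x m| <= C) -> x != y ->
  exists i j, [/\ (i <= J)%N, (j <= J)%N, u i = u j &
    beta_tail beta a y (N * i) != beta_tail beta a y (N * j)].
Proof.
move=> beta1 N0 block recur xC xy; apply: contrapT => noij.
have eqij i j : (i <= J)%N -> (j <= J)%N -> u i = u j ->
    beta_tail beta a y (N * i) = beta_tail beta a y (N * j).
  by move=> iJ jJ uij; apply/eqP/negPn/negP => neq; case: noij; exists i, j.
(* Recurrence of pairs of letters keeps the next letter equal as well, and l < J leaves l + 1 within
   the range of [eqij]. *)
have repr i : exists2 j, (j <= J)%N /\ u j = u i &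
    beta_tail beta a y (N * j) = beta_tail beta a y (N * i).
  elim: i => [|i [j [jJ uji] yji]]; first by exists 0%N.
  have [l lJ [uli uli1]] := recur i; exists l.+1; first by [].
  have yli : beta_tail beta a y (N * l) = beta_tail beta a y (N * i).
    by rewrite -yji; apply: eqij; rewrite ?uji // ltnW.
  apply/eqP; rewrite !mulnS ![(N + _)%N]addnC -subr_eq0.
  by rewrite (beta_tail_shift _ _ (block _ _ uli)) yli subrr mulr0.
pose M : R := \sum_(j < J.+1) `|beta_tail beta a y (N * j)|.
have yM i : `|beta_tail beta a y (N * i)| <= M.
  have [j [jJ _] <-] := repr i; rewrite /M (bigD1 (Ordinal (jJ : (j < J.+1)%N))) //=.
  by rewrite lerDl sumr_ge0.
have xy0 : 0 < `|x - y| by rewrite normr_gt0 subr_eq0.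
have [G G1 lin] := exprn_bound_by_exponential 1 beta1.
(* Bounded tails would bound beta^(N n) |x - y|, hence n |x - y|, against the Archimedean
   property. *)
have bound n : n%:R * `|x - y| <= G * (C + M).
  apply: (@le_trans _ _ (G * (beta ^+ (N * n) * `|x - y|))).
    rewrite mulrA ler_wpM2r ?normr_ge0 //; apply: le_trans (lin n) _.
    by rewrite ler_wpM2l ?ler_weXn2l ?leq_pmull //; lra.
  have beta0 : 0 <= beta ^+ (N * n) by rewrite exprn_ge0 //; lra.
  rewrite ler_wpM2l; [by [] | lra |].
  rewrite -[X in X * _]ger0_norm // -normrM -(beta_tail_sub beta a).
  by apply: le_trans (ler_normB _ _) _; apply: lerD.
have := archi_boundP (_ : 0 <= G * (C + M) / `|x - y|).
set n := Num.bound _ => bnd.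
have : 0 <= G * (C + M) / `|x - y|.
  rewrite divr_ge0 // mulr_ge0 ?addr_ge0 //; first lra.
  - exact: le_trans (normr_ge0 _) (xC 0%N).
  - exact: le_trans (normr_ge0 _) (yM 0%N).
by move=> /bnd; rewrite ltr_pdivrMr // ltNge bound.
Qed.

(** * Finite irrationality measure and conclusion *)

Lemma automatic_irrationality_measure (R : realType) (beta xi : R) (k : nat) :
  algebraic_integer beta -> 1 < beta ->
  (forall z : R[i], other_conjugate beta z -> `|z| <= 1) ->
  0 <= xi -> (2 <= k)%N -> automatic k (beta_digit beta xi) ->
  exists S : nat, forall p q : int, 1 < q -> xi != p%:~R / q%:~R ->
    1 <= `|xi - p%:~R / q%:~R| * q%:~R ^+ S.
Proof.
move=> beta_int beta1 conj1 xi0 k2 /automatic_block[A [u block]].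
have beta0 : 0 <= beta by lra.
set a := beta_digit beta xi in block.
have [J recur] := finite_range_bound (fun i => (u i, u i.+1)).
have [d lower] := int_poly_lower_bound beta_int conj1.
pose C := xi + beta.
have C1 : 1 <= C by rewrite /C; lra.
have C0 : 0 <= C by lra.
have tailC m : 0 <= beta_tail beta a xi m <= C by exact: beta_tail_digit_bound.
have aC t : `|a t|%:~R <= C by exact: beta_digit_bound.
(* On the unit disc each of the two polynomials below is at most C q N (J + 1), so their difference
   is at most K q N. *)
pose K := 2 * C * J.+1%:R.
have K2 : 2 <= K.
  have J1 : 1 <= J.+1%:R :> R by rewrite ler1n.
  rewrite /K; move: (J.+1%:R) J1 => x x1; nra.
have G1 : 1 <= 2 * C * K ^+ d.
  have Kd1 : 1 <= K ^+ d by apply: exprn_ege1; lra.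
  move: (K ^+ d) Kd1 => x x1; nra.
(* These parameters make the lower bound on B equal to 2 C q (K q N)^d. *)
have [T scale] := scale_choice d.+1 d beta1 k2 G1.
exists (T * J.+1)%N => p q q1 xi_neq.
set delta := `|_ - _|; set r : R := q%:~R.
have r2 : 2 <= r by rewrite /r -[2]/(2%:~R) ler_int.
have r0 : 0 <= r by lra.
(* Once delta < 1, |p / q| is at most xi + 1 <= C, which bounds p in terms of q. *)
have [delta1|delta1] := leP 1 delta.
  apply: le_trans delta1 _; rewrite ler_peMr ?normr_ge0 // exprn_ege1 //; lra.
have [n /andP[scale_le scale_ge]] := scale r r2.
set N := (k ^ n)%N in scale_le scale_ge; set B := beta ^+ N in scale_le scale_ge.
have N0 : (0 < N)%N by rewrite expn_gt0 ltnW.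
have N1 : 1 <= N%:R :> R by rewrite ler1n.
have B1 : 1 <= B by apply: exprn_ege1; lra.
have B0 : 0 <= B by lra.
have xi_tail m : `|beta_tail beta a xi m| <= C.
  by have /andP[? ?] := tailC m; rewrite ger0_norm.
have [i [j [iJ jJ uij]]] :=
  beta_tail_separation beta1 N0 (block n) recur xi_tail xi_neq.
set yi := beta_tail _ _ _ _; set yj := beta_tail _ _ _ _ => yij.
have q_neq0 : q != 0 by rewrite gt_eqF // (lt_trans _ q1).
have [Qi Qi_beta Qi_le] := beta_tail_poly beta p (N * i) aC q_neq0.
have [Qj Qj_beta Qj_le] := beta_tail_poly beta p (N * j) aC q_neq0.
have absq : `|q|%:~R = r by rewrite ger0_norm // (le_trans _ (ltW q1)).
have p_le : `|p|%:~R <= C * r.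
  have pE : p%:~R = (p%:~R / q%:~R) * r :> R by rewrite divfK // intr_eq0.
  rewrite intr_norm pE normrM [`|r|]ger0_norm // ler_wpM2r //.
  have : p%:~R / q%:~R = xi - (xi - p%:~R / q%:~R) :> R by ring.
  move=> ->; apply: le_trans (ler_normB _ _) _.
  by rewrite ger0_norm // lerD // ltW // (lt_trans delta1).
pose M := K * r * N%:R.
have M1 : 1 <= M.
  have Kr1 : 1 <= K * r by nra.
  by rewrite /M (le_trans Kr1) // ler_peMr // (le_trans ler01).
have Q_le l : (l <= J)%N ->
    `|p|%:~R + (N * l)%:R * `|q|%:~R * C <= C * r * N%:R * J.+1%:R.
  move=> lJ; rewrite absq natrM -[J.+1%:R]natr1.
  have lJ' : l%:R <= J%:R :> R by rewrite ler_nat.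
  have l0 : 0 <= l%:R :> R by [].
  have Cr0 : 0 <= C * r by rewrite mulr_ge0.
  have -> : N%:R * l%:R * r * C = C * r * N%:R * l%:R by ring.
  rewrite mulrDr mulr1 addrC lerD ?ler_wpM2l ?mulr_ge0 //.
  by apply: le_trans p_le _; rewrite ler_peMr.
have QM z : `|z| <= 1 -> `|(map_poly intr (Qi - Qj)).[z]| <= M%:C%C.
  move=> z1; rewrite rmorphB hornerD hornerN; apply: le_trans (ler_normB _ _) _.
  apply: le_trans (lerD (Qi_le z z1) (Qj_le z z1)) _.
  rewrite -rmorphD lecR; apply: le_trans (lerD (Q_le i iJ) (Q_le j jJ)) _.
  by rewrite (_ : _ + _ = M) // /M /K; ring.
have Q_beta : (map_poly intr (Qi - Qj)).[beta] = r * (yi - yj).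
  by rewrite rmorphB hornerD hornerN Qi_beta Qj_beta mulrBr.
have := lower _ _ M1 QM.
rewrite Q_beta mulf_neq0 ?subr_eq0 //; last by rewrite gt_eqF //; lra.
move=> /(_ isT); rewrite normrM [`|r|]ger0_norm // => low.
set xl := beta_tail beta a xi.
(* Multiplied by B, this difference is that of two tails N places further on, both in [0, C]. *)
have xij : B * `|xl (N * i)%N - xl (N * j)%N| <= C.
  rewrite -[B]ger0_norm; last lra.
  rewrite -normrM -(beta_tail_shift _ _ (block n _ _ uij)).
  have := tailC (N * i + k ^ n)%N; have := tailC (N * j + k ^ n)%N.
  by rewrite ler_norml; lra.
have yxij : `|yi - yj| <= `|xl (N * i)%N - xl (N * j)%N| + B ^+ J * delta.
  have -> : yi - yj = (xl (N * i)%N - xl (N * j)%N)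
      - (B ^+ i - B ^+ j) * (xi - p%:~R / q%:~R).
    rewrite mulrBl -!exprM -!(beta_tail_sub beta a) -/yi -/yj /xl; ring.
  apply: le_trans (ler_normB _ _) _; rewrite lerD2l normrM ler_wpM2r //.
  have BJ l : (l <= J)%N -> 0 <= B ^+ l <= B ^+ J.
    by move=> lJ; rewrite exprn_ge0 ?ler_weXn2l //; lra.
  by have := BJ i iJ; have := BJ j jJ; rewrite ler_norml; lra.
have BJ1 : 1 <= B ^+ J.+1 * delta.
  rewrite exprS -mulrA; set W := r * M ^+ d.
  have W0 : 0 <= W by rewrite mulr_ge0 // exprn_ge0 //; lra.
  have WB : 2 * C * W <= B.
    (* By [xij], this makes W times the difference of the tails of [xi] at most 1/2, so the term in
       [delta] carries the other half. *)
    apply: le_trans scale_le; rewrite le_eqVlt; apply/orP; left.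
    by apply/eqP; rewrite /W /M !exprMn exprS; ring.
  have : 1 <= W * (`|xl (N * i)%N - xl (N * j)%N| + B ^+ J * delta).
    apply: le_trans low _.
    by rewrite mulrAC ler_wpM2l.
  move: xij WB W0 B1 C1.
  have : 0 <= B ^+ J * delta by apply: mulr_ge0; [exact: exprn_ge0 | exact: normr_ge0].
  move: (B ^+ J * delta) `|_| (normr_ge0 (xl (N * i)%N - xl (N * j)%N)).
  move=> X D D0 X0 DC WB W0 B1' C1' low'.
  have WD : 2 * (W * D) <= 1.
    have : B * (2 * (W * D)) <= B * 1.
      apply: le_trans (_ : 2 * C * W <= _); last by rewrite mulr1.
      have -> : B * (2 * (W * D)) = 2 * W * (B * D) by ring.
      have -> : 2 * C * W = 2 * W * C by ring.
      by rewrite ler_wpM2l // mulr_ge0.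
    by rewrite ler_pM2l //; lra.
  have WB2 : 2 * (W * X) <= B * X.
    rewrite mulrA; apply: ler_wpM2r => //; apply: le_trans WB.
    by rewrite ler_wpM2r // ler_peMr.
  by lra.
apply: le_trans BJ1 _; rewrite mulrC ler_wpM2l ?normr_ge0 // exprM.
by rewrite lerXn2r // nnegrE exprn_ge0.
Qed.

Theorem theorem9 (R : realType) (beta xi : R) (k : nat)
    (hbeta : pisot beta \/ salem beta)
    (hxi0 : 0 <= xi) (hxi : liouville xi) (hk : (2 <= k)%N) :
  ~ automatic k (beta_digit beta xi).
Proof.
move=> xi_auto; have [xi_irr xi_approx] := hxi.
have [beta_int beta1 conj1] : [/\ algebraic_integer beta, 1 < beta &
    forall z : R[i], other_conjugate beta z -> `|z| <= 1].
  by case: hbeta => [[? ? conj]|[]]; split=> // z /conj /ltW.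
have [S measure] :=
  automatic_irrationality_measure beta_int beta1 conj1 hxi0 hk xi_auto.
(* The exponent S + 1 beats the measure S, as q^(-S-1) q^S <= 1. *)
have [p [q [q1]]] := xi_approx S.+1%:R (ltr0Sn _ _).
have q_gt1 : 1 < q%:~R :> R by rewrite -[1]/(1%:~R) ltr_int.
have q_gt0 : 0 < q%:~R :> R := lt_trans ltr01 q_gt1.
rewrite powRN powR_mulrn ?(ltW q_gt0) // => close.
have xi_neq : xi != p%:~R / q%:~R.
  apply/eqP => xiE; apply: xi_irr; exists (p%:~R / q%:~R) => //=.
  by rewrite fmorph_div /= !ratr_int xiE.
have := measure p q q1 xi_neq; apply/negP; rewrite -ltNge.
apply: lt_le_trans (_ : q%:~R ^- S.+1 * q%:~R ^+ S <= 1).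
  by rewrite ltr_pM2r // exprn_gt0.
rewrite mulrC ler_pdivrMr ?exprn_gt0 // mul1r ler_weXn2l //; exact: ltW.
Qed.
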